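(* Let $G$ be a compact connected Lie group and $\Theta$ a unitary representation of $G$ on a finite-dimensional Hilbert space $\mathcal{H}_A$. Let $A=\{A^i\}$ be a tensor in canonical form II (CFII), $A^i=\bigoplus_{j=1}^m\bigoplus_{q=1}^{r_j}\mu_{j,q}A^i_j$, where $\{A_j\}$ is a basis of normal tensors (BNT) of $A$ consisting of normal tensors in CFII and $\mu_{j,q}$ are nonzero constants. Suppose $A$ generates a matrix product vector with a global symmetry with respect to $\Theta$ ($\Theta(g)^{\otimes N}|\psi^N_A\rangle=|\psi^N_A\rangle$ for all $N\in\mathbb{N}$, $g\in G$), i.e. $A$ satisfies $$\sum_{i'}\Theta(g)_{i,i'}A^{i'}=X(g)^{-1}A^iX(g)\qquad\forall g\in G,\ \forall i,$$ where $X(g)=\bigoplus_{j=1}^m\bigoplus_{q=1}^{r_j}X_j(g)$ has the same block structure as $A$ and each $X_j(g)$ is a projective representation of $G$. Suppose that $X(g)$ is a projective representation, i.e. all $X_j(g)$ are in the same cohomology class. Then there exist a tensor $B$ with a finite-dimensional physical space $\mathcal{H}_B$ and projective unitary representations $\mathcal{R}(g)$ and $\mathcal{L}(g)$ of $G$ on $\mathcal{H}_B$ with inverse multipliers such that both of the following local symmetries hold: (i) for all $N\ge2$, all sites $2K,2K+1,2K+2$ of the periodic chain of length $2N$ and all $g\in G$, $\mathcal{R}(g)^{[2K]}\otimes\Theta(g)^{[2K+1]}\otimes\mathcal{L}(g)^{[2K+2]}|\psi^N_{AB}\rangle=|\psi^N_{AB}\rangle$; (ii) for all $N\ge2$, all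 neighboring sites $K,K+1$ of the periodic chain of length $N$ and all $g\in G$, $\mathcal{R}(g)^{[K]}\otimes\mathcal{L}(g)^{[K+1]}|\psi^N_B\rangle=|\psi^N_B\rangle$.
   Context: A multiplier of $G$ is a (continuous) function $\gamma:G\times G\to U(1)$ with $\gamma(g,h)\gamma(gh,f)=\gamma(g,hf)\gamma(h,f)$ and $\gamma(g,e)=\gamma(e,g)=1$. A projective unitary representation with multiplier $\gamma$ is a map $\Theta$ from $G$ to unitaries with $\Theta(g)\Theta(h)=\gamma(g,h)\Theta(gh)$; unitary representations have trivial multiplier. All (projective) representations are unitary and finite dimensional. Two projective representations with multipliers $\gamma,\gamma'$ are in the same cohomology class if $\gamma'(g,h)=\gamma(g,h)\mu(g)\mu(h)\mu(gh)^{-1}$ for some function $\mu:G\to U(1)$. Since $X$ enters together with its inverse, each $X_j(g)$ is only determined up to a phase. A tensor $A=\{A^i\}$ of square matrices generates $|\psi_A^N\rangle=\sum\operatorname{Tr}(A^{i_1}\cdots A^{i_N})|i_1\dots i_N\rangle$ (similarly for $B$); $A,B$ together generate $|\psi^N_{AB}\rangle=\sum\operatorname{Tr}(A^{i_1}B^{j_1}\cdots A^{i_N}B^{j_N})|i_1j_1\dots i_Nj_N\rangle$, where odd sites carry $\mathcal{H}_A$, even sites carry $\mathcal{H}_B$, sites labelled modulo $2N$. A superscript $[K]$ indicates the site on which an operator acts. The CP map of a tensor $A=\{A^i\}_{i=1}^d$ is $E_A(Z)=\sum_{i=1}^dA^iZ(A^i)^\dagger$. A tensor is normal if for some $L$ the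 $L$-fold products of its matrices span the full matrix algebra, and its CP map has spectral radius $1$. A tensor is in canonical form (CF) if it is of the form $\bigoplus_k\nu_kA_k^i$ with $A_k$ normal and $\nu_k$ constants; it is in CFII if in addition each $E_{A_k}$ is trace preserving and has a diagonal, positive definite fixed point. A basis of normal tensors (BNT) of a tensor $\bigoplus_k\nu_kA_k$ in CF is a set of normal tensors $\{\hat A_j\}$ such that for every $k$ there exist a unique $\hat A_j$, an invertible matrix $V$ and a phase $e^{i\phi}$ with $A_k^i=e^{i\phi}V^{-1}\hat A_j^iV$ for all $i$. *)

(* Defs.v *)
From HB Require Import structures.
From mathcomp Require Import all_boot all_order all_algebra.
From mathcomp Require Import all_classical all_reals all_analysis.
From mathcomp Require Import complex.
Set Implicit Arguments.
Unset Strict Implicit.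
Unset Printing Implicit Defensive.
Import Order.TTheory GRing.Theory Num.Theory.
Import numFieldNormedType.Exports.
Local Open Scope classical_set_scope.
Local Open Scope ring_scope.
Local Open Scope sesquilinear_scope.

#[short(type="topGroupType")]
HB.structure Definition TopGroup := {G of Group G & Topological G}.

Definition is_topological_group (G : topGroupType) : Prop :=
  continuous (fun p : G * G => (p.1 * p.2)%g) /\
  continuous (fun g : G => (g^-1)%g).

(* In finite dimension, continuity of all directional derivatives of order at
   most k on the open set U is the usual C^k condition. *)
Fixpoint Ck_on (R : realType) (V W : normedModType R) (k : nat)
    (U : set V) (f : V -> W) : Prop :=
  (forall x, U x -> {for x, continuous f}) /\
  match k with
  | 0%N => True
  | k'.+1 => forall v : V,
      (forall x, U x -> derivable f x v) /\ Ck_on k' U (fun x => 'D_v f x)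
  end.

Definition smooth_on (R : realType) (V W : normedModType R)
    (U : set V) (f : V -> W) : Prop :=
  open U /\ forall k, Ck_on k U f.

Record chart (R : realType) (T : Type) (n : nat) := Chart {
  chart_dom : set T;
  chart_cod : set 'rV[R]_n;
  chart_map : T -> 'rV[R]_n;
  chart_inv : 'rV[R]_n -> T }.

Definition is_chart (R : realType) (T : topologicalType) (n : nat)
    (c : chart R T n) : Prop :=
  [/\ open (chart_dom c) /\ open (chart_cod c),
      forall x, chart_dom c x ->
        chart_cod c (chart_map c x) /\ chart_inv c (chart_map c x) = x,
      forall u, chart_cod c u ->
        chart_dom c (chart_inv c u) /\ chart_map c (chart_inv c u) = u,
      forall x, chart_dom c x -> {for x, continuous (chart_map c)} &
      forall u, chart_cod c u -> {for u, continuous (chart_inv c)}].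

Definition is_smooth_atlas (R : realType) (T : topologicalType) (n : nat)
    (S : set (chart R T n)) : Prop :=
  [/\ forall c, S c -> is_chart c,
      forall x : T, exists2 c, S c & chart_dom c x &
      forall c c', S c -> S c' ->
        smooth_on [set u | chart_cod c u /\ chart_dom c' (chart_inv c u)]
                  (fun u => chart_map c' (chart_inv c u))].

Definition smooth_group_ops (R : realType) (G : topGroupType) (n : nat)
    (S : set (chart R G n)) : Prop :=
  (forall c1 c2 c3, S c1 -> S c2 -> S c3 ->
     smooth_on
       [set p : 'rV[R]_n * 'rV[R]_n |
          [/\ chart_cod c1 p.1, chart_cod c2 p.2 &
              chart_dom c3 (chart_inv c1 p.1 * chart_inv c2 p.2)%g]]
       (fun p => chart_map c3 (chart_inv c1 p.1 * chart_inv c2 p.2)%g)) /\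
  (forall c c', S c -> S c' ->
     smooth_on
       [set u | chart_cod c u /\ chart_dom c' ((chart_inv c u)^-1)%g]
       (fun u => chart_map c' ((chart_inv c u)^-1)%g)).

Definition is_lie_group (R : realType) (G : topGroupType) : Prop :=
  [/\ is_topological_group G, hausdorff_space G, @second_countable G &
      exists (n : nat) (S : set (chart R G n)),
        is_smooth_atlas S /\ smooth_group_ops S].

Section Representations.
Variables (R : realType) (G : topGroupType).
Local Notation C := R[i].

(* Purely algebraic; continuity is the separate predicate continuous_multiplier. *)
Definition is_multiplier (gam : G -> G -> C) : Prop :=
  [/\ forall g h, `|gam g h| = 1,
      forall g h f, gam g h * gam (g * h)%g f = gam g (h * f)%g * gam h f &
      forall g, gam g 1%g = 1 /\ gam 1%g g = 1].

Definition continuous_multiplier (gam : G -> G -> C) : Prop :=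
  continuous (fun p : G * G => complex.Re (gam p.1 p.2)) /\
  continuous (fun p : G * G => complex.Im (gam p.1 p.2)).

Definition is_proj_rep (n : nat) (gam : G -> G -> C) (U : G -> 'M[C]_n) : Prop :=
  [/\ is_multiplier gam,
      forall g, U g \is unitarymx &
      forall g h, U g *m U h = gam g h *: U (g * h)%g].

Definition is_unitary_rep (n : nat) (U : G -> 'M[C]_n) : Prop :=
  is_proj_rep (fun _ _ => 1) U.

Definition cohomologous (gam gam' : G -> G -> C) : Prop :=
  exists2 mu : G -> C, forall g, `|mu g| = 1 &
    forall g h, gam' g h = gam g h * mu g * mu h * (mu (g * h)%g)^-1.

End Representations.

Section Tensors.
Variable R : realType.
Local Notation C := R[i].

(* A d-tuple of D x D matrices; the physical space is C^d with its standard
   orthonormal basis. *)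
Definition tensor (d D : nat) := 'I_d -> 'M[C]_D.

Definition cp_map d D (A : tensor d D) (Z : 'M[C]_D) : 'M[C]_D :=
  \sum_(i < d) A i *m Z *m (A i)^t*.

Definition has_spectral_radius D (f : 'M[C]_D -> 'M[C]_D) (rho : C) : Prop :=
  let eigenval l := exists2 Z, Z != 0 & f Z = l *: Z in
  (exists2 l, eigenval l & `|l| = rho) /\ (forall l, eigenval l -> `|l| <= rho).

Definition normal_tensor d D (A : tensor d D) : Prop :=
  (exists2 L, (0 < L)%N &
     <<codom (fun s : {ffun 'I_L -> 'I_d} => \prod_(k < L) A (s k))>>%VS
       = fullv) /\
  has_spectral_radius (cp_map A) 1.

Definition normal_tensor_cf2 d D (A : tensor d D) : Prop :=
  [/\ normal_tensor A,
      forall Z, \tr (cp_map A Z) = \tr Z &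
      exists2 lam : 'rV[C]_D, forall k, 0 < lam 0 k &
        cp_map A (diag_mx lam) = diag_mx lam].

(* A^i = e^{i phi} V^{-1} A'^i V with V invertible; V is allowed to be a priori
   rectangular, W is its two-sided inverse (so that D = D'). *)
Definition gauge_equiv d D D' (A : tensor d D) (A' : tensor d D') : Prop :=
  exists (V : 'M[C]_(D', D)) (W : 'M[C]_(D, D')) (c : C),
    [/\ V *m W = 1%:M, W *m V = 1%:M, `|c| = 1 &
        forall i, A i = c *: (W *m A' i *m V)].

(* The family Ahat, indexed by J, is a basis of normal tensors of a tensor in
   canonical form with blocks A k, k : K. *)
Definition is_BNT d (K J : Type) (D : K -> nat) (Dhat : J -> nat)
    (A : forall k, tensor d (D k)) (Ahat : forall j, tensor d (Dhat j)) : Prop :=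
  (forall j, normal_tensor (Ahat j)) /\
  (forall k, exists! j, gauge_equiv (A k) (Ahat j)).

Definition blocksum m (r D : 'I_m -> nat)
    (M : forall j : 'I_m, 'I_(r j) -> 'M[C]_(D j)) :
    'M[C]_(\sum_(j < m) \sum_(q < r j) D j) :=
  \mxdiag_(j < m) \mxdiag_(q < r j) M j q.

(* (C^d)^{\otimes N}, by coordinates in the product basis. *)
Definition chain d N := {ffun {ffun 'I_N -> 'I_d} -> C}.

Definition mpv d D (A : tensor d D) N : chain d N :=
  [ffun s : {ffun 'I_N -> 'I_d} => \tr (\prod_(k < N) A (s k))].

Definition tensor_op d N (O : 'I_N -> 'M[C]_d) (psi : chain d N) : chain d N :=
  [ffun s : {ffun 'I_N -> 'I_d} =>
     \sum_(t : {ffun 'I_N -> 'I_d}) (\prod_(k < N) O k (s k) (t k)) * psi t].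

(* The chain of 2N sites, labelled modulo 2N, whose odd sites carry C^dA and even
   sites C^dB: for k = 0, ..., N-1, the site 2k+1 is the coordinate k of the first
   component of a configuration and the site 2k+2 is the coordinate k of the
   second one. *)
Definition chain2 dA dB N :=
  {ffun {ffun 'I_N -> 'I_dA} * {ffun 'I_N -> 'I_dB} -> C}.

Definition mpv2 dA dB D (A : tensor dA D) (B : tensor dB D) N : chain2 dA dB N :=
  [ffun s : {ffun 'I_N -> 'I_dA} * {ffun 'I_N -> 'I_dB} =>
     \tr (\prod_(k < N) (A (s.1 k) *m B (s.2 k)))].

Definition tensor_op2 dA dB N (OA : 'I_N -> 'M[C]_dA) (OB : 'I_N -> 'M[C]_dB)
    (psi : chain2 dA dB N) : chain2 dA dB N :=
  [ffun s : {ffun 'I_N -> 'I_dA} * {ffun 'I_N -> 'I_dB} =>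
     \sum_(t : {ffun 'I_N -> 'I_dA} * {ffun 'I_N -> 'I_dB})
        (\prod_(k < N) (OA k (s.1 k) (t.1 k) * OB k (s.2 k) (t.2 k))) * psi t].

Definition at_site d N (K : 'I_N) (O : 'M[C]_d) : 'I_N -> 'M[C]_d :=
  fun k => if k == K then O else 1%:M.

(* For N >= 2 the cyclic neighbour ordS K differs from K. *)
Definition at_neighbors d N (K : 'I_N) (O O' : 'M[C]_d) : 'I_N -> 'M[C]_d :=
  fun k => if k == K then O else if k == ordS K then O' else 1%:M.

Definition global_symmetry (G : Type) d D
    (Theta : G -> 'M[C]_d) (A : tensor d D) : Prop :=
  forall N g, tensor_op (fun _ : 'I_N => Theta g) (mpv A N) = mpv A N.

(* R^{[2k]} (x) Theta^{[2k+1]} (x) L^{[2k+2]}, with 2k the B-site of the cell K and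
   2k+1, 2k+2 the two sites of the next cell. *)
Definition local_symmetry_AB (G : Type) dA dB D (Theta : G -> 'M[C]_dA)
    (Rr Lr : G -> 'M[C]_dB) (A : tensor dA D) (B : tensor dB D) : Prop :=
  forall N, (2 <= N)%N -> forall (K : 'I_N) (g : G),
    tensor_op2 (at_site (ordS K) (Theta g)) (at_neighbors K (Rr g) (Lr g))
      (mpv2 A B N) = mpv2 A B N.

Definition local_symmetry_B (G : Type) dB D
    (Rr Lr : G -> 'M[C]_dB) (B : tensor dB D) : Prop :=
  forall N, (2 <= N)%N -> forall (K : 'I_N) (g : G),
    tensor_op (at_neighbors K (Rr g) (Lr g)) (mpv B N) = mpv B N.

End Tensors.

(* Main.v *)
(** Since the X_j are cohomologous, rephasing them block by block turns X(g) into
    a unitary projective representation U with a single multiplier, and leaves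
    X(g)^-1 A X(g) unchanged because A is block diagonal.  Take for B the maximally
    entangled tensor whose n^2 physical indices label the matrix units of M_n.
    Multiplying B on the right by U(g), or on the left by U(g)^-1, is then the action
    on the physical index of R(g) = 1 (x) U(g), respectively L(g) = conj U(g) (x) 1.
    Hence the local operators act on the virtual level by
    B (U U^-1) A (U U^-1) B and B (U U^-1) B, where everything cancels. *)

Require Import Defs.
From HB Require Import structures.
From mathcomp Require Import all_boot all_order all_algebra.
From mathcomp Require Import all_classical all_reals all_analysis.
From mathcomp Require Import complex mxtens zify.
Set Implicit Arguments.
Unset Strict Implicit.
Unset Printing Implicit Defensive.
Import Order.TTheory GRing.Theory Num.Theory.
Import numFieldNormedType.Exports.
Local Open Scope classical_set_scope.
Local Open Scope ring_scope.
Local Open Scope sesquilinear_scope.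

(** * The maximally entangled tensor and operators on its physical index *)

Definition bell_tensor (R : realType) (n : nat) : tensor R (n * n) n :=
  fun k => delta_mx (mxtens_unindex k).1 (mxtens_unindex k).2.
Arguments bell_tensor R n k : clear implicits.

Lemma bell_tensorE (R : realType) n a b :
  bell_tensor R n (mxtens_index (a, b)) = delta_mx a b.
Proof. by rewrite /bell_tensor mxtens_indexK. Qed.

(** This is the left-hand side of the symmetry condition on [A]. It lets a product of one-site
    operators on a chain be traded for a change of the tensor at each site. *)
Definition act_tensor (R : realType) (d D : nat) (O : 'M[R[i]]_d)
    (A : tensor R d D) : tensor R d D :=
  fun i => \sum_(j < d) O i j *: A j.

Lemma act_tensor1 (R : realType) d D (A : tensor R d D) i :
  act_tensor 1%:M A i = A i.
Proof.
rewrite /act_tensor (bigD1 i) //= mxE eqxx scale1r big1 ?addr0 // => j ji.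
by rewrite mxE eq_sym (negPf ji) scale0r.
Qed.

Lemma sum_mxtens (V : nmodType) m n (F : 'I_(m * n) -> V) :
  \sum_k F k = \sum_i \sum_j F (mxtens_index (i, j)).
Proof.
rewrite pair_bigA /= (reindex (@mxtens_index m n)) //=; first last.
  exists (@mxtens_unindex m n) => k _; [exact: mxtens_indexK|].
  exact: mxtens_unindexK.
by apply: eq_bigr => -[].
Qed.

(** With E_ab the matrix units, E_ab X = sum_d X_bd E_ad: only the second half of the physical index
    moves. *)
Lemma act_bellr (R : realType) n (X : 'M[R[i]]_n) k :
  act_tensor (1%:M *t X) (bell_tensor R n) k = bell_tensor R n k *m X.
Proof.
case: (mxtens_indexP k) => a b.
rewrite /act_tensor sum_mxtens (bigD1 a) //= [X in _ + X]big1 ?addr0; last first.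
  move=> c ca; apply: big1 => d _.
  by rewrite tensmxE mxE eq_sym (negPf ca) mul0r scale0r.
rewrite bell_tensorE [in RHS](matrix_sum_delta X).
rewrite mulmx_sumr [in RHS](bigD1 b) //= [X in _ = _ + X]big1 ?addr0; last first.
  move=> c cb; rewrite mulmx_sumr big1 // => d _.
  by rewrite -scalemxAr mul_delta_mx_0 1?eq_sym // scaler0.
rewrite mulmx_sumr; apply: eq_bigr => d _.
by rewrite bell_tensorE tensmxE mxE eqxx mul1r -scalemxAr mul_delta_mx.
Qed.

(** Here X E_ab = sum_c X_ca E_cb moves only the first half of the index. The summation index comes
    first in X_ca, hence the transpose. *)
Lemma act_belll (R : realType) n (X : 'M[R[i]]_n) k :
  act_tensor (X^T *t 1%:M) (bell_tensor R n) k = X *m bell_tensor R n k.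
Proof.
case: (mxtens_indexP k) => a b.
rewrite /act_tensor sum_mxtens exchange_big (bigD1 b) //=.
rewrite [X in _ + X]big1 ?addr0; last first.
  move=> d db; apply: big1 => c _.
  by rewrite tensmxE [1%:M _ _]mxE eq_sym (negPf db) mulr0 scale0r.
rewrite bell_tensorE [in RHS](matrix_sum_delta X).
rewrite mulmx_suml; apply: eq_bigr => c _.
rewrite mulmx_suml [in RHS](bigD1 a) //= [X in _ = _ + X]big1 ?addr0; last first.
  by move=> d da; rewrite -scalemxAl mul_delta_mx_0 // scaler0.
by rewrite bell_tensorE tensmxE !mxE eqxx mulr1 -scalemxAl mul_delta_mx.
Qed.

(** * Product operators on matrix product vectors, and gauge freedom of the trace *)

Lemma scalemx_prod (K : comPzRingType) n (I : finType) (F : I -> K)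
    (M : I -> 'M[K]_n) :
  \prod_i (F i *: M i) = (\prod_i F i) *: \prod_i M i.
Proof.
elim/big_rec3: _ => [|i x y z _ ->]; first by rewrite scale1r.
by rewrite -[LHS]/(_ *m _) -scalemxAl -scalemxAr scalerA.
Qed.

(** By multilinearity: a product of sums over the sites is a sum over configurations. *)
Lemma tensor_op_mpv (R : realType) d D N (O : 'I_N -> 'M[R[i]]_d)
    (A : tensor R d D) s :
  tensor_op O (mpv A N) s = \tr (\prod_(k < N) act_tensor (O k) A (s k)).
Proof.
rewrite ffunE /act_tensor bigA_distr_bigA raddf_sum /=.
by apply: eq_bigr => t _; rewrite ffunE scalemx_prod mxtraceZ.
Qed.

Lemma tensor_op2_mpv2 (R : realType) dA dB D N
    (OA : 'I_N -> 'M[R[i]]_dA) (OB : 'I_N -> 'M[R[i]]_dB)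
    (A : tensor R dA D) (B : tensor R dB D) s :
  tensor_op2 OA OB (mpv2 A B N) s =
  \tr (\prod_(k < N) (act_tensor (OA k) A (s.1 k) *m
                      act_tensor (OB k) B (s.2 k))).
Proof.
(* The two sites of a cell are merged into one with a composite index, so that a single distribution
   over cells suffices. *)
pose F k (p : 'I_dA * 'I_dB) :=
  (OA k (s.1 k) p.1 * OB k (s.2 k) p.2) *: (A p.1 *m B p.2).
transitivity (\tr (\prod_(k < N) \sum_p F k p)); last first.
  congr (\tr _); apply: eq_bigr => k _.
  rewrite /act_tensor mulmx_suml -(pair_bigA _ (fun i j => F k (i, j))) /=.
  apply: eq_bigr => i _; rewrite mulmx_sumr; apply: eq_bigr => j _.
  by rewrite /F -scalemxAl -scalemxAr scalerA.
rewrite ffunE bigA_distr_bigA raddf_sum /=.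
(* Distributivity yields configurations of pairs, while [chain2] uses pairs of configurations; [pr]
   is the unzipping bijection and [zp] its inverse. *)
pose pr (f : {ffun 'I_N -> 'I_dA * 'I_dB}) :
  {ffun 'I_N -> 'I_dA} * {ffun 'I_N -> 'I_dB} :=
    ([ffun k => (f k).1], [ffun k => (f k).2]).
rewrite (reindex pr) /=; last first.
  pose zp (t : {ffun 'I_N -> 'I_dA} * {ffun 'I_N -> 'I_dB}) :
    {ffun 'I_N -> 'I_dA * 'I_dB} := [ffun k => (t.1 k, t.2 k)].
  exists zp => [f _|[t1 t2] _].
    by apply/ffunP => k; rewrite !ffunE /= -surjective_pairing.
  by congr pair; apply/ffunP => k; rewrite !ffunE.
apply: eq_bigr => f _; rewrite ffunE scalemx_prod mxtraceZ /=.
congr (_ * _); last congr (\tr _); apply: eq_bigr => k _; by rewrite !ffunE.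
Qed.

(** At each bond the inserted factors meet as Y Z = 1; cyclicity of the trace closes the last
    bond. *)
Lemma trace_prod_gauge (K : comPzRingType) n N (M Y Z : 'I_N -> 'M[K]_n) :
  (forall k, Y k *m Z k = 1%:M) ->
  \tr (\prod_(k < N) (Z k *m M k *m Y (ordS k))) = \tr (\prod_(k < N) M k).
Proof.
case: N M Y Z => [|N] M Y Z YZ; first by rewrite !big_ord0.
(* Indexing by naturals allows induction on the length, and the reduction modulo [N.+1] makes
   [y N.+1] equal to [y 0]. *)
pose y k := Y (inord (k %% N.+1)); pose z k := Z (inord (k %% N.+1)).
pose f k := M (inord k).
have yz k : y k *m z k = 1%:M by exact: YZ.
have tele j : \prod_(0 <= k < j.+1) (z k *m f k *m y k.+1) =
    z 0%N *m \prod_(0 <= k < j.+1) f k *m y j.+1.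
  elim: j => [|j IH]; first by rewrite !big_nat1.
  rewrite big_nat_recr //= [in RHS]big_nat_recr //= {}IH.
  rewrite -!mulmxE -!mulmxA; congr (_ *m (_ *m _)).
  by rewrite mulmxA yz mul1mx.
transitivity (\tr (\prod_(0 <= k < N.+1) (z k *m f k *m y k.+1))).
  congr (\tr _); rewrite big_mkord; apply: eq_bigr => k _.
  rewrite /z /f /y modn_small // !inord_val; congr (_ *m Y _).
  by apply/val_inj; rewrite /= inordK ?ltn_mod.
rewrite tele mxtrace_mulC mulmxA.
have -> : y N.+1 = y 0%N by rewrite /y modnn mod0n.
rewrite yz mul1mx big_mkord; congr (\tr _); apply: eq_bigr => k _.
by rewrite /f inord_val.
Qed.

Lemma ordS_neq N (k : 'I_N) : (2 <= N)%N -> ordS k != k.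
Proof.
move=> N2; case: k => k kN; rewrite -val_eqE /=.
move: kN; rewrite leq_eqVlt => /predU1P[kN|kN]; first by rewrite kN modnn; lia.
by rewrite modn_small // gtn_eqF.
Qed.

(** A gauge change supported on the single bond between [k0] and its successor. With at least two
    sites the ends of this bond are distinct, so each receives only one factor. *)
Lemma trace_prod_link (K : comPzRingType) n N (k0 : 'I_N)
    (M M' : 'I_N -> 'M[K]_n) (X X' : 'M[K]_n) :
  (2 <= N)%N -> X *m X' = 1%:M ->
  M' k0 = M k0 *m X -> M' (ordS k0) = X' *m M (ordS k0) ->
  (forall k, k != k0 -> k != ordS k0 -> M' k = M k) ->
  \tr (\prod_(k < N) M' k) = \tr (\prod_(k < N) M k).
Proof.
move=> N2 XX' M'0 M'1 M'E.
pose Y k := if k == ordS k0 then X else 1%:M.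
pose Z k := if k == ordS k0 then X' else 1%:M.
rewrite -(@trace_prod_gauge _ _ _ M Y Z); last first.
  by move=> k; rewrite /Y /Z; case: ifP; rewrite ?mulmx1.
congr (\tr _); apply: eq_bigr => k _; rewrite /Y /Z (inj_eq (@ordS_inj N)).
case: (eqVneq k k0) => [->|k_k0].
  by rewrite eq_sym (negPf (ordS_neq k0 N2)) mul1mx.
by case: eqP => [->|/eqP k1]; rewrite ?mul1mx mulmx1 // M'E.
Qed.

(** * Algebra of block-diagonal matrices *)

Lemma mxdiagM (K : pzSemiRingType) p (p_ : 'I_p -> nat)
    (B B' : forall j, 'M[K]_(p_ j)) :
  \mxdiag_j B j *m \mxdiag_j B' j = \mxdiag_j (B j *m B' j).
Proof.
rewrite {2}/mxdiag mul_mxdiag_mxblock /mxdiag; apply: eq_mxblock => i j.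
case: eqP => [<-|_]; last by rewrite mulmx0.
by rewrite !conform_mx_id.
Qed.

Lemma map_mxdiag (K K' : nzRingType) (f : {rmorphism K -> K'}) p
    (p_ : 'I_p -> nat) (B : forall j, 'M[K]_(p_ j)) :
  map_mx f (\mxdiag_j B j) = \mxdiag_j map_mx f (B j).
Proof.
apply/matrixP => i j; rewrite !mxE; case: ifP => _; last first.
  by rewrite !mxE rmorph0.
(* The default argument of [conform_mx] has to be an image under [map_mx f] before the map can be
   pulled out. *)
rewrite -[X in conform_mx X (map_mx f _)](map_mx0 f).
by rewrite -map_conform_mx [RHS]mxE.
Qed.

Section BlockSum.
Variables (R : realType) (m : nat) (r D : 'I_m -> nat).
Implicit Types M : forall j, 'I_(r j) -> 'M[R[i]]_(D j).

Lemma eq_blocksum M M' : (forall j q, M j q = M' j q) ->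
  blocksum M = blocksum M'.
Proof. by move=> MM'; apply: eq_mxdiag => j; apply: eq_mxdiag. Qed.

Lemma blocksum_inj M M' : blocksum M = blocksum M' ->
  forall j q, M j q = M' j q.
Proof. by rewrite /blocksum => /eq_mxdiagP MM' j; apply/eq_mxdiagP/MM'. Qed.

Lemma blocksumM M M' :
  blocksum M *m blocksum M' = blocksum (fun j q => M j q *m M' j q).
Proof. by rewrite mxdiagM; apply: eq_mxdiag => j; rewrite mxdiagM. Qed.

Lemma blocksumZ a M : a *: blocksum M = blocksum (fun j q => a *: M j q).
Proof.
rewrite -mul_scalar_mx -mxdiagZ mxdiagM; apply: eq_mxdiag => j.
rewrite -mxdiagZ mxdiagM; apply: eq_mxdiag => q.
by rewrite mul_scalar_mx.
Qed.

Lemma blocksum1 :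
  blocksum (fun j (_ : 'I_(r j)) => 1%:M : 'M[R[i]]_(D j)) = 1%:M.
Proof.
by rewrite -mxdiagZ; apply: eq_mxdiag => j; rewrite -mxdiagZ.
Qed.

Lemma blocksum0 : blocksum (fun j (_ : 'I_(r j)) => 0 : 'M[R[i]]_(D j)) = 0.
Proof. by rewrite -mxdiag0; apply: eq_mxdiag => j; rewrite -mxdiag0. Qed.

Lemma blocksum_trmxC M :
  (blocksum M)^t* = blocksum (fun j q => (M j q)^t*).
Proof.
rewrite /blocksum tr_mxdiag map_mxdiag; apply: eq_mxdiag => j.
by rewrite tr_mxdiag map_mxdiag.
Qed.

Lemma blocksum_unitary M : (forall j q, M j q \is unitarymx) ->
  blocksum M \is unitarymx.
Proof.
move=> uM; apply/unitarymxP; rewrite blocksum_trmxC blocksumM -blocksum1.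
by apply: eq_blocksum => j q; exact/unitarymxP.
Qed.

End BlockSum.

(** * Phases, unitarity and tensor products of projective representations *)

Lemma trmxCZ (C : numClosedFieldType) m n (a : C) (M : 'M[C]_(m, n)) :
  (a *: M)^t* = Num.conj a *: M^t*.
Proof. by apply/matrixP => i j; rewrite !mxE rmorphM. Qed.

(** The phase enters as conj(a) a = 1. This is why rephasing the blocks of [X] preserves the
    symmetry condition. *)
Lemma trmxCZ_conjmx (C : numClosedFieldType) m n (a : C) (M : 'M[C]_m)
    (Y : 'M[C]_(m, n)) :
  `|a| = 1 -> (a *: Y)^t* *m M *m (a *: Y) = Y^t* *m M *m Y.
Proof.
move=> a1; rewrite trmxCZ -!scalemxAl -scalemxAr scalerA mulrC -normCK a1.
by rewrite expr1n scale1r.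
Qed.

Lemma unitarymxZ (C : numClosedFieldType) n (a : C) (M : 'M[C]_n) :
  `|a| = 1 -> M \is unitarymx -> a *: M \is unitarymx.
Proof.
move=> a1 /unitarymxP uM; apply/unitarymxP.
rewrite trmxCZ -scalemxAl -scalemxAr uM scalerA.
by rewrite -normCK a1 expr1n scale1r.
Qed.

Lemma tensmx11 (K : pzRingType) m n :
  1%:M *t 1%:M = 1%:M :> 'M[K]_(m * n).
Proof.
apply/matrixP => i j; case: (mxtens_indexP i) => a b.
case: (mxtens_indexP j) => c d; rewrite tensmxE !mxE.
by rewrite (inj_eq (can_inj (@mxtens_indexK _ _))) xpair_eqE -natrM mulnb.
Qed.

Lemma tensmxZl (K : pzRingType) m n p q a (M : 'M[K]_(m, n))
    (M' : 'M[K]_(p, q)) : (a *: M) *t M' = a *: (M *t M').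
Proof. by apply/matrixP => i j; rewrite !mxE mulrA. Qed.

Lemma tensmxZr (K : comPzRingType) m n p q a (M : 'M[K]_(m, n))
    (M' : 'M[K]_(p, q)) : M *t (a *: M') = a *: (M *t M').
Proof. by apply/matrixP => i j; rewrite !mxE mulrCA. Qed.

Lemma tensmx_unitary (C : numClosedFieldType) m n (M : 'M[C]_m)
    (M' : 'M[C]_n) :
  M \is unitarymx -> M' \is unitarymx -> M *t M' \is unitarymx.
Proof.
move=> /unitarymxP uM /unitarymxP uM'; apply/unitarymxP.
by rewrite trmx_tens map_mxT tensmx_mul uM uM' tensmx11.
Qed.

Lemma invr_norm1 (C : numClosedFieldType) (a : C) :
  `|a| = 1 -> a^-1 = Num.conj a.
Proof. by move=> a1; rewrite invC_norm a1 expr1n invr1 mul1r. Qed.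

Lemma is_multiplierV (R : realType) (G : topGroupType) (gam : G -> G -> R[i]) :
  is_multiplier gam -> is_multiplier (fun g h => (gam g h)^-1).
Proof.
case=> gam1 gamM game; split=> [g h|g h f|g].
- by rewrite normfV gam1 invr1.
- by rewrite -!invfM gamM.
- by case: (game g) => -> ->; rewrite invr1.
Qed.

Lemma is_proj_rep_tensr (R : realType) (G : topGroupType) m n
    (gam : G -> G -> R[i]) (U : G -> 'M[R[i]]_n) :
  is_proj_rep gam U -> is_proj_rep gam (fun g => (1%:M : 'M[R[i]]_m) *t U g).
Proof.
case=> mgam uU UM; split=> // [g|g h].
  by rewrite tensmx_unitary //; apply/unitarymxP; rewrite trmx1 map_mx1 mulmx1.
by rewrite tensmx_mul mulmx1 UM tensmxZr.
Qed.

(** The transposed adjoint is the entrywise conjugate, a ring morphism on matrices. It conjugates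
    the multiplier, and the conjugate of a phase is its inverse. *)
Lemma is_proj_rep_conj_tensl (R : realType) (G : topGroupType) m n
    (gam : G -> G -> R[i]) (U : G -> 'M[R[i]]_n) :
  is_proj_rep gam U ->
  is_proj_rep (fun g h => (gam g h)^-1)
    (fun g => ((U g)^t*)^T *t (1%:M : 'M[R[i]]_m)).
Proof.
case=> mgam uU UM; split=> [|g|g h]; first exact: is_multiplierV.
  rewrite tensmx_unitary //; apply/unitarymxP.
    rewrite (_ : (((U g)^t*)^T)^t* = (U g)^T).
      by rewrite -trmx_mul (unitarymxP (uU g)) trmx1.
    by apply/matrixP => i j; rewrite !mxE conjCK.
  by rewrite trmx1 map_mx1 mulmx1.
rewrite tensmx_mul mulmx1 !map_trmx !trmxK -map_mxM UM map_mxZ tensmxZl.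
by congr (_ *: _); case: mgam => gam1 _ _; rewrite invr_norm1.
Qed.

(** * Nonvanishing of the generated vectors *)

Lemma mulmx_delta_sandwich (K : comPzRingType) n (M : 'M[K]_n) a b :
  delta_mx b a *m M *m delta_mx b a = M a b *: delta_mx b a.
Proof.
(* Each matrix unit is split as a column times a row, which leaves the 1 x 1 matrix with entry M_ab
   in the middle. *)
rewrite -[X in X *m M](mul_delta_mx (0 : 'I_1)).
rewrite -[X in _ *m X](mul_delta_mx (0 : 'I_1)).
rewrite -!mulmxA (mulmxA M) (mulmxA (delta_mx 0 a)) -colE -rowE.
rewrite [row _ _]mx11_scalar mul_scalar_mx -scalemxAr mul_delta_mx.
by rewrite !mxE.
Qed.

Lemma mxtrace_mul_delta (K : comPzRingType) n (M : 'M[K]_n) a b :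
  \tr (M *m delta_mx b a) = M a b.
Proof.
rewrite -(mul_delta_mx (0 : 'I_1)) mulmxA mxtrace_mulC mulmxA -rowE.
by rewrite -colE /mxtrace big_ord1 !mxE.
Qed.

(** Since E_ba has rank one, every further factor M E_ba only contributes the scalar M_ab. *)
Lemma trace_prod_delta (K : comPzRingType) n N (M : 'M[K]_n) a b :
  \tr (\prod_(k < N.+1) (M *m delta_mx b a)) = M a b ^+ N.+1.
Proof.
rewrite (_ : \prod_(k < _) _ = M a b ^+ N *: (M *m delta_mx b a)).
  by rewrite mxtraceZ mxtrace_mul_delta exprSr.
elim: N => [|N IH]; first by rewrite big_ord_recl big_ord0 mulr1 scale1r.
rewrite big_ord_recr /= IH -[LHS]/(_ *m _) -scalemxAl -mulmxA (mulmxA _ M).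
by rewrite mulmx_delta_sandwich -scalemxAr scalerA exprSr.
Qed.

(** The constant configuration (a, a) has coefficient 1. *)
Lemma mpv_bell_neq0 (R : realType) n N (a : 'I_n) :
  (0 < N)%N -> mpv (bell_tensor R n) N <> 0.
Proof.
case: N => // N _ /ffunP /(_ [ffun=> mxtens_index (a, a)])/eqP; rewrite !ffunE.
under eq_bigr do rewrite ffunE bell_tensorE -[delta_mx _ _]mul1mx.
by rewrite trace_prod_delta mxE eqxx expr1n oner_eq0.
Qed.

(** The configuration with [i] on all odd sites and (b, a) on all even sites has coefficient
    (A^i_ab)^N. *)
Lemma mpv2_bell_neq0 (R : realType) d n N (A : tensor R d n) i a b :
  A i a b != 0 -> (0 < N)%N -> mpv2 A (bell_tensor R n) N <> 0.
Proof.
case: N => // N Aiab _ /ffunP.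
move=> /(_ ([ffun=> i], [ffun=> mxtens_index (b, a)]))/eqP; rewrite !ffunE.
under eq_bigr do rewrite !ffunE bell_tensorE.
by rewrite trace_prod_delta expf_eq0 (negPf Aiab) andbF.
Qed.

(** Otherwise the CP map would vanish and have only the eigenvalue 0, whereas spectral radius 1
    provides an eigenvalue of modulus 1. *)
Lemma normal_tensor_neq0 (R : realType) d D (A : tensor R d D) :
  normal_tensor A -> exists i, A i != 0.
Proof.
case=> _ [[l [Z Z0 AZ] l1] _]; apply: contrapT => A0.
have Ai0 i : A i = 0.
  by apply: contrapT => /eqP Ai; apply: A0; exists i.
have := AZ; rewrite /cp_map big1; last first.
  by move=> i _; rewrite Ai0 !mul0mx.
move=> /esym/eqP; rewrite scaler_eq0 (negPf Z0) orbF => /eqP l0.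
by move/eqP: l1; rewrite l0 normr0 eq_sym oner_eq0.
Qed.

(** * The local symmetries and the choice of a common multiplier *)

Lemma local_symmetry_B_bell (R : realType) (G : Type) n
    (U : G -> 'M[R[i]]_n) : (forall g, U g \is unitarymx) ->
  local_symmetry_B (fun g => 1%:M *t U g) (fun g => ((U g)^t*)^T *t 1%:M)
    (bell_tensor R n).
Proof.
move=> uU N N2 K g; apply/ffunP => s; rewrite tensor_op_mpv [RHS]ffunE.
apply: (trace_prod_link (k0 := K) N2 (unitarymxP (uU g))).
- by rewrite /at_neighbors eqxx act_bellr.
- by rewrite /at_neighbors (negPf (ordS_neq K N2)) eqxx act_belll.
- move=> k /negPf kK /negPf kSK; rewrite /at_neighbors kK kSK.
  exact: act_tensor1.
Qed.

(** Cell [K] becomes A B U and the next one (U^* A U)(U^* B) = U^* A B, with U^* the adjoint: again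
    a gauge change on one bond. *)
Lemma local_symmetry_AB_bell (R : realType) (G : Type) dA n
    (Theta : G -> 'M[R[i]]_dA) (A : tensor R dA n) (U : G -> 'M[R[i]]_n) :
  (forall g, U g \is unitarymx) ->
  (forall g i, act_tensor (Theta g) A i = (U g)^t* *m A i *m U g) ->
  local_symmetry_AB Theta (fun g => 1%:M *t U g)
    (fun g => ((U g)^t*)^T *t 1%:M) A (bell_tensor R n).
Proof.
move=> uU AU N N2 K g; apply/ffunP => s; rewrite tensor_op2_mpv2 [RHS]ffunE.
have UU := unitarymxP (uU g).
apply: (trace_prod_link (k0 := K) N2 UU).
- rewrite /at_site /at_neighbors eqxx eq_sym (negPf (ordS_neq K N2)).
  by rewrite act_tensor1 act_bellr mulmxA.
- rewrite /at_site /at_neighbors (negPf (ordS_neq K N2)) eqxx AU act_belll.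
  by rewrite -!mulmxA (mulmxA (U g)) UU mul1mx.
- move=> k /negPf kK /negPf kSK; rewrite /at_site /at_neighbors kK kSK.
  by rewrite !act_tensor1.
Qed.

Theorem proposition12 (R : realType) (G : topGroupType)
  (hLie : is_lie_group R G)
  (hcompact : compact [set: G])
  (hconn : connected [set: G])
  (dA : nat) (Theta : G -> 'M[R[i]]_dA)
  (hTheta : is_unitary_rep Theta)
  (m : nat) (hm : (0 < m)%N)
  (r : 'I_m -> nat) (hr : forall j, (0 < r j)%N)
  (D : 'I_m -> nat)
  (Aj : forall j : 'I_m, tensor R dA (D j))
  (hCFII : forall j, normal_tensor_cf2 (Aj j))
  (hBNT : is_BNT (fun k : {j : 'I_m & 'I_(r j)} => Aj (tag k)) Aj)
  (mu : forall j : 'I_m, 'I_(r j) -> R[i])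
  (hmu : forall j q, mu j q != 0)
  (A : tensor R dA (\sum_(j < m) \sum_(q < r j) D j))
  (hA : forall i, A i = blocksum (fun j q => mu j q *: Aj j i))
  (hglobal : global_symmetry Theta A)
  (gam : 'I_m -> G -> G -> R[i])
  (Xj : forall j : 'I_m, G -> 'M[R[i]]_(D j))
  (hXj : forall j, is_proj_rep (gam j) (Xj j))
  (X : G -> 'M[R[i]]_(\sum_(j < m) \sum_(q < r j) D j))
  (hX : forall g, X g = blocksum (fun j (_ : 'I_(r j)) => Xj j g))
  (hsym : forall g i,
     \sum_(i' < dA) Theta g i i' *: A i' = invmx (X g) *m A i *m X g)
  (hclass : forall j k, cohomologous (gam j) (gam k)) :
  exists (dB : nat) (B : tensor R dB (\sum_(j < m) \sum_(q < r j) D j))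
         (gamR : G -> G -> R[i]) (Rr Lr : G -> 'M[R[i]]_dB),
    [/\ is_proj_rep gamR Rr /\ is_proj_rep (fun g h => (gamR g h)^-1) Lr,
        (forall j, continuous_multiplier (gam j)) -> continuous_multiplier gamR,
        (forall N, (0 < N)%N -> mpv B N <> 0 /\ mpv2 A B N <> 0),
        local_symmetry_AB Theta Rr Lr A B &
        local_symmetry_B Rr Lr B].
Proof.
pose j0 := Ordinal hm.
(* Block [j0] serves as reference: [nu j] is the phase function carrying the multiplier of block [j]
   to that of [j0]. *)
pose rephases j (nu : G -> R[i]) := (forall g, `|nu g| = 1) /\
  (forall g h, gam j0 g h = gam j g h * nu g * nu h / nu (g * h)%g).
have [|nu nuP] := @choice _ _ rephases.
  by move=> j; have [nu nu1 nuM] := hclass j j0; exists nu; split.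
have nu1 j g : `|nu j g| = 1 by case: (nuP j).
pose U g := blocksum (fun j (_ : 'I_(r j)) => nu j g *: Xj j g).
have uXj j g : Xj j g \is unitarymx by case: (hXj j).
have uX g : X g \is unitarymx by rewrite hX; apply: blocksum_unitary.
have uU g : U g \is unitarymx.
  by apply: blocksum_unitary => j q; exact: unitarymxZ.
have mgam : is_multiplier (gam j0) by case: (hXj j0).
have UM g h : U g *m U h = gam j0 g h *: U (g * h)%g.
  rewrite blocksumM blocksumZ; apply: eq_blocksum => j q.
  rewrite -scalemxAl -scalemxAr scalerA; have [_ _ ->] := hXj j.
  (* By the choice of [nu], the scalar of block [j] is [gam j0 g h * nu j (g * h)], so its prefactor
     no longer depends on [j]. *)
  rewrite !scalerA (nuP j).2 divfK -?normr_gt0 ?nu1 //; congr (_ *: _).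
  by rewrite mulrC mulrA.
have pU : is_proj_rep (gam j0) U by [].
have AU g i : act_tensor (Theta g) A i = (U g)^t* *m A i *m U g.
  have XC : (X g)^t* = blocksum (fun j (_ : 'I_(r j)) => (Xj j g)^t*).
    by rewrite hX; exact: blocksum_trmxC.
  have UC : (U g)^t* = blocksum (fun j (_ : 'I_(r j)) => (nu j g *: Xj j g)^t*).
    exact: blocksum_trmxC.
  rewrite /act_tensor hsym (invmx_unitary (uX g)) XC UC hX hA.
  rewrite 2![in LHS]blocksumM 2![in RHS]blocksumM.
  by apply: eq_blocksum => j q; rewrite trmxCZ_conjmx.
(* A nonzero matrix of the normal block [j0], scaled by the nonzero [mu], supplies the nonzero entry
   of [A] that makes the mixed vectors nonzero. *)
have [i /eqP Ai0] := normal_tensor_neq0 (hBNT.1 j0).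
have [a [b Aiab]] : exists a b, A i a b != 0.
  apply: contrapT => A0; apply: Ai0; pose q0 := Ordinal (hr j0).
  have : A i = blocksum (fun j (_ : 'I_(r j)) => 0 : 'M[R[i]]_(D j)).
    rewrite blocksum0; apply/matrixP => a b; rewrite mxE; apply: contrapT.
    by move=> /eqP Aiab; apply: A0; exists a, b.
  rewrite hA => /blocksum_inj /(_ j0 q0) /eqP.
  by rewrite scaler_eq0 (negPf (hmu _ _)) /= => /eqP.
(* As the common multiplier is [gam j0] itself, its continuity is an instance of the assumed
   continuity. *)
exists (_ * _)%N, (bell_tensor R _), (gam j0), (fun g => 1%:M *t U g),
  (fun g => ((U g)^t*)^T *t 1%:M).
split.
- by split; [exact: is_proj_rep_tensr|exact: is_proj_rep_conj_tensl].
- exact.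
- move=> N N0; split; first exact: (mpv_bell_neq0 a).
  exact: (mpv2_bell_neq0 Aiab).
- exact: local_symmetry_AB_bell.
- exact: local_symmetry_B_bell.
Qed.
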